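(* Consider the latent contextual bandit transfer problem with source domain $\pi$ (probabilities $p$) and target domain $\pi^{\ast}$ (probabilities $p^{\ast}$) over a context $Z$ with values in $\mathcal{Z}$, a proxy $W$, an action $X$ and a reward $Y$, under a covariate shift on the latent context $Z$ (all as specified in the context). Then the $w$-specific causal effect $p^{\ast}(y\mid w,do(x))$ is not directly transportable from $\pi$ to $\pi^{\ast}$, and the transport formula of $p^{\ast}(y\mid w,do(x))$ is $$p^{\ast}(y\mid w,do(x))=\sum_{z\in\mathcal{Z}}p(y\mid z,x)\,p^{\ast}(z\mid w).$$
   Context: A structural causal model (SCM) is a tuple $\langle \boldsymbol{V},\boldsymbol{U},\mathcal{F},P_{\boldsymbol{U}}\rangle$ with endogenous variables $\boldsymbol{V}$, exogenous variables $\boldsymbol{U}$ with joint law $P_{\boldsymbol{U}}$, and functions $\mathcal{F}$ generating each endogenous variable from its parents. The intervention $do(x)$ replaces the mechanism generating $X$ by the constant $x$. Setting. The source domain $\pi$ and the target domain $\pi^{\ast}$ are characterized by SCMs $M$ and $M^{\ast}$, which entail distributions $P_{W,Z,X,Y}$ and $P^{\ast}_{W,Z,X,Y}$. The context $Z$ takes values in $\mathcal{Z}\subseteq\mathbb{R}^{d_1}$, the proxy $W$ takes values in $\mathcal{W}\subseteq\mathbb{R}^{d_2}$ with $d_1\ll d_2$, the action (arm) $X$ takes values in $\mathcal{X}=\{1,\ldots,K\}$, and the reward $Y$ takes values in $\mathcal{Y}\subseteq\mathbb{R}$. In both domains $Z$ is drawn from its marginal law, $W$ is generated from $Z$ (edge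 $Z\to W$), and $Y$ is generated from $Z$ and $X$ (edges $Z\to Y$, $X\to Y$). In the source domain a dataset $D\sim P_{W,Z,X,Y}$ of $(w,z,x,y)$ is available, with the action selected based on $Z$. In the target domain $Z$ is latent: at each step the agent observes only the proxy $w$, takes an action $x$ and observes a reward $y$. Covariate shift on the latent context: $P_Z\neq P^{\ast}_Z$, while $P_{W\mid Z}=P^{\ast}_{W\mid Z}$ and $P_{Y\mid Z,X}=P^{\ast}_{Y\mid Z,X}$. This discrepancy is encoded in a selection diagram, i.e. the causal graph with an added selection node $S$ pointing at the variable whose mechanism may differ between the domains; here $S$ points to $Z$ only. Notation. $p(y\mid w,do(x))$ and $p^{\ast}(y\mid w,do(x))$ are the causal effects of the action $x$ on the reward conditioned on observing the proxy value $w$, in the source and target domain respectively; they are called $w$-specific causal effects. $p(y\mid z,x)$ is an observational conditional probability in the source domain, and $p^{\ast}(z\mid w)$ an observational conditional probability in the target domain. Terminology. A causal effect is directly transportable from $\pi$ to $\pi^{\ast}$ if the effect in the target domain is the same as the effect in the source domain; for the $w$-specific effect this means $p^{\ast}(y\mid w,do(x))=p(y\mid w,do(x))$. A transport formula is an expression of the target-domain causal effect that involves only available interventional and observational distributions of the source domain and the observational distribution of the target domain. *)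

(* Defs.v *)
From HB Require Import structures.
From mathcomp Require Import all_boot all_order all_algebra.
From mathcomp Require Import all_classical all_reals all_analysis.

Set Implicit Arguments.
Unset Strict Implicit.
Unset Printing Implicit Defensive.

Import Order.TTheory GRing.Theory Num.Theory.
Import numFieldNormedType.Exports.

Local Open Scope classical_set_scope.
Local Open Scope ring_scope.
Local Open Scope ereal_scope.

(* Structural causal models with endogenous variables Z (context), W (proxy),
   X (action) and Y (reward), and one exogenous variable for each of them.
   [d.-tuple R] is the measurable space R^d with the product sigma-algebra.

   [exo_indep]: the causal graph has no bidirected edge, i.e. the exogenous
   variables are mutually independent under their joint law.

   The parents of Z, W, Y are {}, {Z}, {Z, X}. The mechanism of X may read Z
   and W, because its parents differ between the two domains (see
   [action_from_context] and [action_from_proxy]). *)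
Record scm (R : realType) (d1 d2 : nat) := Scm {
  dispZ : measure_display ; dispW : measure_display ;
  dispX : measure_display ; dispY : measure_display ;
  exoZ : measurableType dispZ ; exoW : measurableType dispW ;
  exoX : measurableType dispX ; exoY : measurableType dispY ;
  exo_law : probability (exoZ * exoW * exoX * exoY)%type R ;
  exo_indep : forall A B C D,
    measurable A -> measurable B -> measurable C -> measurable D ->
    exo_law (A `*` B `*` C `*` D) =
      exo_law [set u | A u.1.1.1] * exo_law [set u | B u.1.1.2] *
      exo_law [set u | C u.1.2] * exo_law [set u | D u.2] ;
  mechZ : {mfun exoZ >-> d1.-tuple R} ;
  mechW : {mfun (d1.-tuple R * exoW)%type >-> d2.-tuple R} ;
  mechX : {mfun (d1.-tuple R * d2.-tuple R * exoX)%type >-> nat} ;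
  mechY : {mfun (d1.-tuple R * nat * exoY)%type >-> R} }.

Notation exo M := (exoZ M * exoW M * exoX M * exoY M)%type.

(* [do_scm M x] is the submodel of the intervention do(x). *)
Definition do_scm (R : realType) (d1 d2 : nat) (M : scm R d1 d2) (x : nat) :
    scm R d1 d2 :=
  @Scm R d1 d2 _ _ _ _ (exoZ M) (exoW M) (exoX M) (exoY M) (exo_law M)
    (@exo_indep _ _ _ M) (mechZ M) (mechW M)
    (cst x : {mfun (d1.-tuple R * d2.-tuple R * exoX M)%type >-> nat})
    (mechY M).

Section endogenous_variables.
Context (R : realType) (d1 d2 : nat) (M : scm R d1 d2).

Definition varZ (u : exo M) : d1.-tuple R := mechZ M u.1.1.1.
Definition varW (u : exo M) : d2.-tuple R := mechW M (varZ u, u.1.1.2).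
Definition varX (u : exo M) : nat := mechX M (varZ u, varW u, u.1.2).
Definition varY (u : exo M) : R := mechY M (varZ u, varX u, u.2).
Definition varZX (u : exo M) : (d1.-tuple R * nat)%type := (varZ u, varX u).

Let mu1 : measurable_fun [set: exo M] (fun u => u.1).
Proof. exact: measurable_fst. Qed.
Let mu11 : measurable_fun [set: exo M] (fun u => u.1.1).
Proof. exact: (measurableT_comp measurable_fst mu1). Qed.

Lemma measurable_varZ : measurable_fun setT varZ.
Proof.
apply: (measurableT_comp (measurable_funPT (mechZ M))).
exact: (measurableT_comp measurable_fst mu11).
Qed.
HB.instance Definition _ := isMeasurableFun.Build _ _ _ _ varZ measurable_varZ.

Lemma measurable_varW : measurable_fun setT varW.
Proof.
apply: (measurableT_comp (measurable_funPT (mechW M))).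
apply: measurable_fun_pair; first exact: measurable_varZ.
exact: (measurableT_comp measurable_snd mu11).
Qed.
HB.instance Definition _ := isMeasurableFun.Build _ _ _ _ varW measurable_varW.

Lemma measurable_varX : measurable_fun setT varX.
Proof.
apply: (measurableT_comp (measurable_funPT (mechX M))).
apply: measurable_fun_pair.
  by apply: measurable_fun_pair; [exact: measurable_varZ|exact: measurable_varW].
exact: (measurableT_comp measurable_snd mu1).
Qed.
HB.instance Definition _ := isMeasurableFun.Build _ _ _ _ varX measurable_varX.

Lemma measurable_varZX : measurable_fun setT varZX.
Proof.
by apply: measurable_fun_pair; [exact: measurable_varZ|exact: measurable_varX].
Qed.
HB.instance Definition _ :=
  isMeasurableFun.Build _ _ _ _ varZX measurable_varZX.

Lemma measurable_varY : measurable_fun setT varY.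
Proof.
apply: (measurableT_comp (measurable_funPT (mechY M))).
by apply: measurable_fun_pair; [exact: measurable_varZX|exact: measurable_snd].
Qed.
HB.instance Definition _ := isMeasurableFun.Build _ _ _ _ varY measurable_varY.

End endogenous_variables.

(* [k] is (a version of) the conditional law of [T] given [V] under [P]. *)
Definition is_cond_law d dV dT (U : measurableType d) (SV : measurableType dV)
    (ST : measurableType dT) (R : realType) (P : probability U R)
    (V : {mfun U >-> SV}) (T : {mfun U >-> ST}) (k : R.-pker SV ~> ST) : Prop :=
  forall A B, measurable A -> measurable B ->
    P (V @^-1` A `&` T @^-1` B) = \int[distribution P V]_(v in A) k v B.

Section conditionals.
Context (R : realType) (d1 d2 : nat).
Implicit Type M : scm R d1 d2.

Definition lawZ M : probability (d1.-tuple R) R :=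
  distribution (exo_law M) (@varZ _ _ _ M).
Definition lawW M : probability (d2.-tuple R) R :=
  distribution (exo_law M) (@varW _ _ _ M).
Definition lawZX M : probability (d1.-tuple R * nat)%type R :=
  distribution (exo_law M) (@varZX _ _ _ M).

(* p(w | z) *)
Definition cond_W_Z M (k : R.-pker (d1.-tuple R) ~> (d2.-tuple R)) : Prop :=
  is_cond_law (exo_law M) (@varZ _ _ _ M) (@varW _ _ _ M) k.

(* p(z | w) *)
Definition cond_Z_W M (k : R.-pker (d2.-tuple R) ~> (d1.-tuple R)) : Prop :=
  is_cond_law (exo_law M) (@varW _ _ _ M) (@varZ _ _ _ M) k.

(* p(y | z, x) *)
Definition cond_Y_ZX M (k : R.-pker (d1.-tuple R * nat) ~> R) : Prop :=
  is_cond_law (exo_law M) (@varZX _ _ _ M) (@varY _ _ _ M) k.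

(* p(y | w, do(x)) *)
Definition w_specific_effect M (x : nat) (k : R.-pker (d2.-tuple R) ~> R) :
    Prop :=
  let Mx := do_scm M x in
  is_cond_law (exo_law Mx) (@varW _ _ _ Mx) (@varY _ _ _ Mx) k.

End conditionals.

Section transfer_problem.
Context (R : realType) (d1 d2 : nat).
Variables (Zs : set (d1.-tuple R)) (Ws : set (d2.-tuple R)) (K : nat)
  (Ys : set R).
Implicit Type M Ms : scm R d1 d2.

Definition is_arm (x : nat) : Prop := (1 <= x <= K)%N.

Definition takes_values M : Prop :=
  [/\ forall u, Zs (mechZ M u),
      forall z u, Zs z -> Ws (mechW M (z, u)),
      forall z w u, Zs z -> Ws w -> is_arm (mechX M (z, w, u)) &
      forall z x u, Zs z -> is_arm x -> Ys (mechY M (z, x, u))].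

Definition action_from_context M : Prop :=
  forall z w w' u, mechX M (z, w, u) = mechX M (z, w', u).

Definition action_from_proxy M : Prop :=
  forall z z' w u, mechX M (z, w, u) = mechX M (z', w, u).

(* Equality of conditional laws of the two domains means that they have a
   common version. *)
Definition covariate_shift M Ms : Prop :=
  [/\ exists2 A, measurable A & lawZ M A <> lawZ Ms A,
      exists2 k, cond_W_Z M k & cond_W_Z Ms k &
      exists2 k, cond_Y_ZX M k & cond_Y_ZX Ms k].

(* Selection diagram in which no selection node points to W or Y: their
   mechanisms agree in the two domains. The exogenous spaces may differ, so
   that a mechanism f is compared through the law of f(parents, noise) for
   each value of the parents. *)
Definition same_mechanisms_WY M Ms : Prop :=
  (forall z B, Zs z -> measurable B ->
    exo_law M [set u | B (mechW M (z, u.1.1.2))] =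
    exo_law Ms [set u | B (mechW Ms (z, u.1.1.2))]) /\
  (forall z x B, Zs z -> is_arm x -> measurable B ->
    exo_law M [set u | B (mechY M (z, x, u.2))] =
    exo_law Ms [set u | B (mechY Ms (z, x, u.2))]).

(* Source [M], target [Ms]. The mechanism of X in the target is the policy of
   the agent and is not related to the one in the source. *)
Definition latent_bandit_transfer M Ms : Prop :=
  [/\ takes_values M /\ takes_values Ms,
      action_from_context M, action_from_proxy Ms,
      same_mechanisms_WY M Ms & covariate_shift M Ms].

(* Positivity: p( . | z, x) is determined by the source distribution at
   almost every context z of the target population. *)
Definition positivity M Ms (x : nat) : Prop :=
  forall A, measurable A -> lawZX M (A `*` [set x]) = 0 -> lawZ Ms A = 0.

(* The effect is the same in both domains for every pair of models that is
   compatible with the assumptions. By positivity, lawW Ms is absolutely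
   continuous with respect to lawW M, so that p(y | w, do(x)) is determined at
   lawW Ms-almost every w. *)
Definition directly_transportable (x : nat) : Prop :=
  forall M Ms, latent_bandit_transfer M Ms -> positivity M Ms x ->
  forall k ks, w_specific_effect M x k -> w_specific_effect Ms x ks ->
  \forall w \ae lawW Ms, forall B, measurable B -> ks w B = k w B.

End transfer_problem.

(* Main.v *)
(* Formula: as the noise of Y is independent of the other noises, the law of Y
   under do(x) given the latent context z is that of mechY (z, x, noise), a
   kernel that is a version of p(y | z, x) and is common to the two domains.
   Averaging it over p*(z | w) gives the effect in the target; positivity moves
   the null set on which p(y | z, x) is undetermined to a null set of contexts
   of the target.
   Failure of direct transport: let Z be uniform on {z0, z1} in the source and
   always z0 in the target, W and X constant and Y = y0 exactly when Z = z0.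
   Then p(y0 | w, do(x)) = 1/2 while p*(y0 | w, do(x)) = 1. *)
Require Import Defs.
From HB Require Import structures.
From mathcomp Require Import all_boot all_order all_algebra.
From mathcomp Require Import all_classical all_reals all_analysis.
From mathcomp Require Import measurable_realfun ring.

Local Open Scope classical_set_scope.
Local Open Scope ring_scope.
Local Open Scope ereal_scope.

Import Order.TTheory GRing.Theory Num.Theory.
Import numFieldNormedType.Exports.

Set Implicit Arguments.
Unset Strict Implicit.
Unset Printing Implicit Defensive.

(** * Almost-everywhere uniqueness of kernels into the reals *)

(** By density of the rationals, every open half-line is a countable union of the rational
    half-lines it contains; the generator is thereby countable. *)
Lemma measurable_rat_halfline (R : realType) :
  @measurable _ R = <<s range (fun q : rat => `]-oo, (ratr q : R)[%classic) >>.
Proof.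
rewrite [LHS](RGenInftyO.measurableE R); apply/seteqP; split.
  apply: smallest_sub; first exact: smallest_sigma_algebra.
  move=> _ [r ->].
  have -> : `]-oo, r[%classic = \bigcup_(q in [set q : rat | (ratr q < r)%R])
      `]-oo, (ratr q : R)[%classic.
    apply/seteqP; split=> s /=; rewrite in_itv/=.
      move=> /rat_in_itvoo[q]; rewrite in_itv/= => /andP[sq qr].
      by exists q => //=; rewrite in_itv.
    by move=> [q /= qr]; rewrite in_itv/= => sq; exact: lt_trans qr.
  rewrite bigcup_mkcond.
  apply: (@countable_bigcupT_measurable _ (g_sigma_algebraType
    (range (fun q : rat => `]-oo, (ratr q : R)[%classic)))) => // q.
  case: ifPn => _; last exact: measurable0.
  by apply: sub_sigma_algebra; exists q.
apply: smallest_sub; first exact: smallest_sigma_algebra.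
by move=> _ [q _ <-]; apply: sub_sigma_algebra; exists (ratr q).
Qed.

(** Rational half-lines are stable under intersection (take the [min] of the endpoints) and those
    with natural endpoints exhaust the line, so uniqueness of measures on a pi-system applies. *)
Lemma finite_measure_eq_rat (R : realType) (m1 m2 : {measure set R -> \bar R}) :
  m1 setT < +oo ->
  (forall q : rat, m1 `]-oo, (ratr q)[%classic = m2 `]-oo, (ratr q)[%classic) ->
  forall B, measurable B -> m1 B = m2 B.
Proof.
move=> m1oo m12 B mB.
apply: (measure_unique (range (fun q : rat => `]-oo, (ratr q : R)[%classic))
  (fun n => `]-oo, (ratr n%:R : R)[%classic)) => //.
- exact: measurable_rat_halfline.
- move=> _ _ [p _ <-] [q _ <-]; exists (Num.min p q) => //.
  apply/seteqP; split=> s /=; rewrite !in_itv/=.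
    by move=> sm; split; apply: lt_le_trans sm _;
      rewrite ler_rat ge_min lexx ?orbT.
  by case=> sp sq; case: (leP p q).
- apply/seteqP; split=> // s _; exists (Num.truncn `|s|%R).+1 => //=.
  by rewrite in_itv/= ratr_nat (le_lt_trans (ler_norm s))// truncnS_gt.
- by move=> _ [q _ <-].
- by move=> n; apply: le_lt_trans m1oo; apply: le_measure; rewrite ?inE.
Qed.

(* The exceptional null set does not depend on B because countably many
   half-lines determine a finite measure on R. *)
Lemma ae_eq_kernel d (S : measurableType d) (R : realType)
    (mu : probability S R) (k1 : R.-pker S ~> R) (k2 : R.-ker S ~> R) :
  (forall A B, measurable A -> measurable B ->
    \int[mu]_(v in A) k1 v B = \int[mu]_(v in A) k2 v B) ->
  \forall v \ae mu, forall B, measurable B -> k1 v B = k2 v B.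
Proof.
move=> k12.
have k1q (q : rat) : \forall v \ae mu,
    k1 v `]-oo, (ratr q)[%classic = k2 v `]-oo, (ratr q)[%classic.
  have mI : measurable `]-oo, (ratr q : R)[%classic by exact: measurable_itv.
  apply: (filterS (P := [set v | setT v -> k1 v `]-oo, (ratr q)[%classic =
    k2 v `]-oo, (ratr q)[%classic])); first by move=> v; exact.
  apply: integral_ae_eq => //.
  - apply/integrableP; split; first exact: measurable_kernel.
    apply: (@le_lt_trans _ _ (\int[mu]_v 1)).
      apply: ge0_le_integral => //.
        by apply: measurableT_comp => //; exact: measurable_kernel.
      move=> v _; rewrite gee0_abs// -(prob_kernel (s := k1) v).
      by rewrite le_measure ?inE.
    by rewrite integral_cst// mul1e (le_lt_trans (probability_le1 _ _))// ltry.
  - exact: measurable_kernel.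
  - by move=> A _ mA; rewrite k12.
(* Enumerating the rationals through [unpickle] merges countably many null sets into one; an index
   that codes no rational imposes nothing. *)
have {k1q} : \forall v \ae mu, forall n (q : rat), unpickle n = Some q ->
    k1 v `]-oo, (ratr q)[%classic = k2 v `]-oo, (ratr q)[%classic.
  apply: ae_foralln => n; case: (unpickle n) => [q|]; last exact: aeW.
  by apply: filterS (k1q q) => v ? _ [<-].
apply: filterS => v k12v; apply: finite_measure_eq_rat.
  by rewrite prob_kernel ltry.
by move=> q; apply: (k12v (pickle q)); rewrite pickleK.
Qed.

(** * Independence of the noise of Y from the three other noises *)

Definition mfun_of d1 d2 (S : measurableType d1) (T : measurableType d2)
    (f : S -> T) (mf : measurable_fun setT f) : {mfun S >-> T} :=
  HB.pack f (isMeasurableFun.Build _ _ _ _ f mf).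

(** As functions of [E], both sides are finite measures on the product: the image under [(f, g)] of
    [P] restricted to [Q], and that of [P] scaled by [P Q]. They agree on rectangles, a generating
    pi-system. *)
Lemma indep_pair_event d d1 d2 (U : measurableType d) (S : measurableType d1)
    (T : measurableType d2) (R : realType) (P : probability U R)
    (f : {mfun U >-> S}) (g : {mfun U >-> T}) (Q : set U) :
  measurable Q ->
  (forall A B, measurable A -> measurable B ->
    P (f @^-1` A `&` g @^-1` B `&` Q) = P (f @^-1` A `&` g @^-1` B) * P Q) ->
  forall E, measurable E ->
    P ((fun u => (f u, g u)) @^-1` E `&` Q) =
    P ((fun u => (f u, g u)) @^-1` E) * P Q.
Proof.
move=> mQ PQ E mE.
have mfg : measurable_fun setT (fun u => (f u, g u)).
  exact: measurable_fun_pair.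
have Qfin : P Q \is a fin_num by exact: fin_num_measure.
(* [mscale] takes a nonnegative real, so the factor [P Q] passes through [fine]. *)
have Qge0 : (0 <= fine (P Q))%R by rewrite fine_ge0.
rewrite muleC -[in RHS](fineK Qfin).
have PQoo : mrestr P mQ setT < +oo.
  by rewrite /mrestr setTI (le_lt_trans (probability_le1 P mQ))// ltry.
pose rects := [set A `*` B | A in @measurable _ S & B in @measurable _ T].
have pushE (m : {measure set U -> \bar R}) :
    {mh : {measure set (S * T) -> \bar R} | forall A,
      mh A = m ((fun u => (f u, g u)) @^-1` A)}.
  by unshelve eexists
    (pushforward m (fun u => (f u, g u)) : {measure set _ -> \bar R}).
have [m1 m1E] := pushE (mrestr P mQ).
have [m2 m2E] := pushE (mscale (NngNum Qge0) P).
suff : m1 E = m2 E by rewrite m1E m2E.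
apply: (measure_unique rects (fun=> setT)) => //.
- exact: measurable_prod_measurableType.
- move=> _ _ [A mA [B mB <-]] [A' mA' [B' mB' <-]]; rewrite -setXI.
  exists (A `&` A'); first exact: measurableI.
  by exists (B `&` B') => //; exact: measurableI.
- by move=> _; exists setT => //; exists setT => //; rewrite setXTT.
- by rewrite bigcup_const.
- move=> _ [A mA [B mB <-]]; rewrite m1E m2E /mrestr/= /mscale/= fineK// muleC.
  exact: PQ.
- by move=> _; rewrite m1E; exact: PQoo.
Qed.

Section exogenous.
Context (R : realType) (d1 d2 : nat) (M : scm R d1 d2).

Definition noiseY (u : exo M) : exoY M := u.2.
HB.instance Definition _ :=
  isMeasurableFun.Build _ _ _ _ noiseY measurable_snd.

Definition noiseZWX (u : exo M) : (exoZ M * exoW M * exoX M)%type := u.1.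
HB.instance Definition _ :=
  isMeasurableFun.Build _ _ _ _ noiseZWX measurable_fst.

(** In this form, replacing some of the events by [setT] yields the product rule for fewer
    noises. *)
Lemma exo_law_rect A B C D :
  measurable A -> measurable B -> measurable C -> measurable D ->
  exo_law M ([set u | A u.1.1.1] `&` [set u | B u.1.1.2] `&`
    ([set u | C u.1.2] `&` [set u | D u.2])) =
  exo_law M [set u | A u.1.1.1] * exo_law M [set u | B u.1.1.2] *
  exo_law M [set u | C u.1.2] * exo_law M [set u | D u.2].
Proof.
move=> mA mB mC mD; rewrite -exo_indep//; congr (exo_law M _).
by apply/seteqP; split=> u /=; tauto.
Qed.

(** [exo_indep] speaks of rectangles only. [indep_pair_event] is applied twice: first to the pair of
    noises of Z and W against an event on those of X and Y, then to that pair joined with the noise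
    of X against an event on that of Y. *)
Lemma exo_law_ZWX_Y E D : measurable E -> measurable D ->
  exo_law M (noiseZWX @^-1` E `&` noiseY @^-1` D) =
  exo_law M (noiseZWX @^-1` E) * exo_law M (noiseY @^-1` D).
Proof.
have mu1 : measurable_fun [set: exo M] (fun u => u.1) by exact: measurable_fst.
have mu11 : measurable_fun [set: exo M] (fun u => u.1.1).
  exact: (measurableT_comp measurable_fst mu1).
have mu111 : measurable_fun [set: exo M] (fun u => u.1.1.1).
  exact: (measurableT_comp measurable_fst mu11).
have mu112 : measurable_fun [set: exo M] (fun u => u.1.1.2).
  exact: (measurableT_comp measurable_snd mu11).
have mu12 : measurable_fun [set: exo M] (fun u => u.1.2).
  exact: (measurableT_comp measurable_snd mu1).
have mC C : measurable C -> measurable [set u : exo M | C u.1.2].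
  by move=> mC; rewrite -[X in measurable X]setTI; exact: mu12.
have mD D' : measurable D' -> measurable [set u : exo M | D' u.2].
  by move=> mD'; rewrite -[X in measurable X]setTI; exact: measurable_snd.
have PT T : T = setT -> exo_law M T = 1 by move=> ->; exact: probability_setT.
have ZW_XY C D' F : measurable C -> measurable D' -> measurable F ->
    exo_law M ([set u | F u.1.1] `&` ([set u | C u.1.2] `&` [set u | D' u.2])) =
    exo_law M [set u | F u.1.1] *
    exo_law M ([set u | C u.1.2] `&` [set u | D' u.2]).
  move=> mC' mD' mF.
  have -> : [set u : exo M | F u.1.1] = (fun u => (u.1.1.1, u.1.1.2)) @^-1` F.
    by apply/seteqP; split=> -[[[? ?] ?] ?].
  apply: (indep_pair_event (f := mfun_of mu111) (g := mfun_of mu112)) => //.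
    by apply: measurableI; [exact: mC|exact: mD].
  move=> A B mA mB; rewrite [LHS]exo_law_rect//.
  have := @exo_law_rect A B setT setT mA mB measurableT measurableT.
  rewrite (PT [set u | setT u.1.2])//.
  rewrite setIT !mule1 !setIT => ->.
  have := @exo_law_rect setT setT C D' measurableT measurableT mC' mD'.
  rewrite (PT [set u | setT u.1.1.1])//.
  by rewrite setIT !mul1e !setTI => ->; rewrite !muleA.
move=> mE mD'.
have -> : noiseZWX @^-1` E = (fun u => (u.1.1, u.1.2)) @^-1` E.
  by apply/seteqP; split=> -[[[? ?] ?] ?].
apply: (indep_pair_event (f := mfun_of mu11) (g := mfun_of mu12)) => //.
  exact: mD.
move=> F C mF mC'; rewrite -setIA [LHS]ZW_XY//.
have := ZW_XY C setT F mC' measurableT mF.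
rewrite (_ : [set u | setT u.2] = setT)// !setIT => ->.
have := @exo_law_rect setT setT C D measurableT measurableT mC' mD'.
rewrite (PT [set u | setT u.1.1.1])//.
by rewrite setIT !mul1e !setTI => ->; rewrite !muleA.
Qed.

Lemma exo_law_prod E : measurable E ->
  exo_law M E =
  (distribution (exo_law M) noiseZWX \x distribution (exo_law M) noiseY) E.
Proof.
move=> mE; apply/esym; apply: product_measure_unique => // A B mA mB.
rewrite -[RHS]exo_law_ZWX_Y//; congr (exo_law M _).
Qed.

End exogenous.

(** * Integrating out the noise of Y *)

Section noise_kernel.
Context (R : realType) (d1 d2 : nat) (M : scm R d1 d2).
Context d (T : measurableType d) (h : {mfun (T * exoY M)%type >-> R}).

(** The law of [h (t, noise of Y)] as a function of [t]. Composing the constant kernel of the noise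
    with a Dirac kernel gives measurability in [t] for free. With [h := mechY M] it is the law of
    the reward at given [(z, x)]. *)
Definition noise_kernel : R.-sfker T ~> R :=
  (kprobability (measurable_cst (distribution (exo_law M) (@noiseY _ _ _ M)
     : pprobability (exoY M) R)) : R.-pker T ~> exoY M)
  \; kdirac (measurable_funPT h).

Lemma noise_kernelE t B : measurable B ->
  noise_kernel t B = exo_law M [set u | B (h (t, u.2))].
Proof.
move=> mB.
transitivity (\int[distribution (exo_law M) (@noiseY _ _ _ M)]_y
    (\1_((fun y => h (t, y)) @^-1` B) y)%:E).
  by [].
rewrite integral_indic//; first by rewrite setIT.
rewrite -[X in measurable X]setTI.
by apply: (measurableT_comp (measurable_funPT h)).
Qed.

(** Freezing lemma: under a product law, the measure of an event is the integral of the measures of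
    its sections, here those at a fixed value of the three other noises. Outside [F] the section is
    empty. *)
Lemma exo_law_noise_kernel
    (V : {mfun (exoZ M * exoW M * exoX M)%type >-> T}) F B :
  measurable F -> measurable B ->
  exo_law M [set u | F u.1 /\ B (h (V u.1, u.2))] =
  \int[exo_law M]_(u in [set u | F u.1]) noise_kernel (V u.1) B.
Proof.
move=> mF mB.
have mhV : measurable_fun setT (fun u : exo M => h (V u.1, u.2)).
  apply: (measurableT_comp (measurable_funPT h)).
  apply: measurable_fun_pair => //.
  exact: (measurableT_comp (measurable_funPT V) measurable_fst).
have mG : measurable [set u : exo M | F u.1 /\ B (h (V u.1, u.2))].
  apply: measurableI.
    by rewrite -[X in measurable X]setTI; exact: measurable_fst.
  by rewrite -[X in measurable X]setTI; exact: mhV.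
have mk : measurable_fun setT (fun s => noise_kernel (V s) B).
  exact: (measurableT_comp (measurable_kernel noise_kernel _ mB)
    (measurable_funPT V)).
rewrite exo_law_prod// /product_measure1.
rewrite -(@ge0_integral_pushforward _ _ _ _ R (@noiseZWX _ _ _ M) _
  (exo_law M) F (fun s => noise_kernel (V s) B))//; first last.
  exact: measurable_funTS.
rewrite [RHS]integral_mkcond; apply: eq_integral => s _ /=.
rewrite patchE; case: ifPn => [/set_mem Fs|/negP Fs]; last first.
  rewrite (_ : xsection _ _ = set0) ?measure0//.
  apply/seteqP; split=> y //; rewrite /xsection/= inE/= => -[Fs' _].
  by apply: Fs; rewrite inE.
rewrite noise_kernelE//; congr (exo_law M _).
apply/seteqP; split=> u /=; rewrite /xsection/= inE/=; first by case.
by [].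
Qed.

End noise_kernel.

(** * Integrals against restricted measures, conditional laws and countable sets *)

Lemma integral_mrestr d (T : measurableType d) (R : realType)
    (mu : {measure set T -> \bar R}) (A : set T) (mA : measurable A)
    (f : T -> \bar R) :
  measurable_fun setT f -> (forall t, 0 <= f t) ->
  \int[mrestr mu mA]_t f t = \int[mu]_(t in A) f t.
Proof.
move=> mf f0.
rewrite (@ge0_negligible_integral _ _ _ (mrestr mu mA) setT (~` A))//.
- rewrite setTD setCK; apply: eq_measure_integral => B mB BA.
  by rewrite [LHS]/(mu (B `&` A)) (setIidl BA).
- exact: measurableC.
- by rewrite /= /mrestr setICl measure0.
Qed.

Section restricted_law.
Context d (T : measurableType d) (R : realType) (P : probability T R).
Context (A : set T) (mA : measurable A).

(** The restricted law is made a kernel from [unit] so that it can be composed with a conditional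
    law and [integral_kcomp] applies. *)
Definition krestr (_ : unit) : {measure set T -> \bar R} := mrestr P mA.

Let measurable_krestr U : measurable U -> measurable_fun setT (krestr ^~ U).
Proof. by move=> mU; exact: measurable_cst. Qed.

HB.instance Definition _ := isKernel.Build _ _ _ _ _ krestr measurable_krestr.

Let krestr_uub : measure_fam_uub krestr.
Proof.
(* The uniform bound must be strict and the mass can reach 1, hence 2. *)
exists 2%R => t; rewrite /krestr/= /mrestr setTI.
by rewrite (le_lt_trans (probability_le1 _ mA))// lte_fin ltr1n.
Qed.

HB.instance Definition _ := Kernel_isFinite.Build _ _ _ _ _ krestr krestr_uub.

End restricted_law.

Lemma integral_cond_law d dV dT (U : measurableType d) (SV : measurableType dV)
    (ST : measurableType dT) (R : realType) (P : probability U R)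
    (V : {mfun U >-> SV}) (T : {mfun U >-> ST}) (k : R.-pker SV ~> ST) :
  is_cond_law P V T k ->
  forall A (f : ST -> \bar R), measurable A ->
  measurable_fun setT f -> (forall t, 0 <= f t) ->
  \int[P]_(u in V @^-1` A) f (T u) =
  \int[distribution P V]_(v in A) \int[k v]_t f t.
Proof.
move=> PVT A f mA mf f0.
have mVA : measurable (V @^-1` A).
  by rewrite -[X in measurable X]setTI; exact: measurable_funPT.
pose l := krestr (distribution P V) mA.
pose k' : R.-sfker (unit * SV)%type ~> ST := kernel.kernel_snd k.
transitivity (\int[kcomp l k' tt]_t f t); last first.
  rewrite integral_kcomp// /l /krestr integral_mrestr//.
    apply: measurable_fun_integral_kernel => // B mB.
    exact: measurable_kernel.
  by move=> v; exact: integral_ge0.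
rewrite -(integral_mrestr _ mVA)//; last exact: measurableT_comp.
transitivity (\int[pushforward (mrestr P mVA) T]_t f t).
  by rewrite ge0_integral_pushforward.
apply: eq_measure_integral => B mB _.
transitivity (P (V @^-1` A `&` T @^-1` B)); first by rewrite setIC.
rewrite [LHS](PVT A B mA mB); apply/esym.
by apply: integral_mrestr => //; exact: measurable_kernel.
Qed.

Lemma measurable_tuple_set1 d (T : measurableType d) n (t : n.-tuple T) :
  (forall a : T, measurable [set a]) -> measurable [set t].
Proof.
move=> m1.
have -> : [set t] =
    \bigcap_(i in [set: 'I_n]) ((@tnth _ T)^~ i) @^-1` [set tnth t i].
  apply/seteqP; split=> [_ -> //|s /= st].
  by apply: eq_from_tnth => i; exact: st.
apply: fin_bigcap_measurable => // i _.
by rewrite -[X in measurable X]setTI; exact: measurable_tnth.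
Qed.

(** An injection of [D] into the naturals cuts [D] into fibres that are empty or singletons, and the
    integral is additive over them. *)
Lemma integral_countable d (T : measurableType d) (R : realType)
    (mu : {measure set T -> \bar R}) (D : set T) (f : T -> \bar R) :
  (forall t : T, measurable [set t]) -> countable D -> measurable_fun setT f ->
  (forall t, 0 <= f t) ->
  \int[mu]_(t in D) f t = \esum_(t in D) (f t * mu [set t]).
Proof.
move=> m1 /countable_injP[e einj] mf f0.
pose F n := [set t | D t /\ e t = n].
have F1 n : F n = set0 \/ exists t, F n = [set t].
  have [->|/set0P[t [Dt etn]]] := eqVneq (F n) set0; [by left|right].
  exists t; apply/seteqP; split=> [s [Ds esn]|_ ->//].
  by apply: einj; rewrite ?inE// esn etn.
have DF : D = \bigcup_n F n.
  by apply/seteqP; split=> [t Dt|t [n _ []//]]; exists (e t).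
have mF n : measurable (F n) by case: (F1 n) => [->|[t ->]].
have tF : trivIset setT F by move=> m n _ _ [t [[_ <-] [_ <-]]].
rewrite {1}DF ge0_integral_bigcup//; last exact: measurable_funTS.
rewrite DF nneseries_sum_bigcup//; last by move=> t; exact: mule_ge0.
apply: eq_eseriesr => n _; case: (F1 n) => [->|[t ->]].
  by rewrite integral_set0 esum_set0.
rewrite esum_set1 ?mule_ge0//.
rewrite (eq_integral (cst (f t))); last by move=> s /[!inE] ->.
by rewrite integral_cst.
Qed.

(** * The reward in one model, observed and under intervention *)

Section observed_reward.
Context (R : realType) (d1 d2 : nat) (M : scm R d1 d2).

(** Z, W and (Z, X) do not read the noise of Y; as functions of the three other noises they fit
    [exo_law_noise_kernel]. *)
Let zwx_Z (s : exoZ M * exoW M * exoX M) := mechZ M s.1.1.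
Let zwx_W (s : exoZ M * exoW M * exoX M) := mechW M (zwx_Z s, s.1.2).
Let zwx_ZX (s : exoZ M * exoW M * exoX M) :=
  (zwx_Z s, mechX M (zwx_Z s, zwx_W s, s.2)).

Let measurable_zwx_Z : measurable_fun setT zwx_Z.
Proof.
apply: (measurableT_comp (measurable_funPT (mechZ M))).
exact: (measurableT_comp measurable_fst measurable_fst).
Qed.

Let measurable_zwx_W : measurable_fun setT zwx_W.
Proof.
apply: (measurableT_comp (measurable_funPT (mechW M))).
apply: measurable_fun_pair => //.
exact: (measurableT_comp measurable_snd measurable_fst).
Qed.

Let measurable_zwx_ZX : measurable_fun setT zwx_ZX.
Proof.
apply: measurable_fun_pair => //.
apply: (measurableT_comp (measurable_funPT (mechX M))).
apply: measurable_fun_pair => //; exact: measurable_fun_pair.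
Qed.

(** The noise of Y is independent of (Z, X), so [noise_kernel (mechY M)] has the integrals that
    define p(y | z, x). *)
Lemma cond_Y_ZX_ae (p : R.-pker (d1.-tuple R * nat) ~> R) :
  cond_Y_ZX M p ->
  \forall zx \ae lawZX M, forall B, measurable B ->
    p zx B = noise_kernel (mechY M) zx B.
Proof.
move=> pM; apply: ae_eq_kernel => A B mA mB; rewrite -[LHS]pM//.
rewrite ge0_integral_pushforward//; last first.
  by apply: measurable_funTS; exact: measurable_kernel.
have mF : measurable (zwx_ZX @^-1` A).
  by rewrite -[X in measurable X]setTI; exact: measurable_zwx_ZX.
exact: (exo_law_noise_kernel (mechY M) (mfun_of measurable_zwx_ZX) mF mB).
Qed.

Lemma do_effect x (k : R.-pker (d2.-tuple R) ~> R) : w_specific_effect M x k ->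
  forall A B, measurable A -> measurable B ->
  \int[lawW M]_(w in A) k w B =
  \int[exo_law M]_(u in @varW _ _ _ M @^-1` A)
    noise_kernel (mechY M) (varZ u, x) B.
Proof.
(* do(x) changes neither W nor the exogenous law, so [lawW M] is convertible to the law of W in
   [do_scm M x]. *)
move=> kM A B mA mB; rewrite -[LHS]kM//.
have mF : measurable (zwx_W @^-1` A).
  by rewrite -[X in measurable X]setTI; exact: measurable_zwx_W.
have mV : measurable_fun setT (fun s => (zwx_Z s, x)).
  exact: measurable_fun_pair.
exact: (exo_law_noise_kernel (mechY M) (mfun_of mV) mF mB).
Qed.

End observed_reward.

(** * The transport formula *)

Section transport.
Context (R : realType) (d1 d2 K : nat).
Context (Zs : set (d1.-tuple R)) (Ws : set (d2.-tuple R)) (Ys : set R).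
Hypothesis mZs : measurable Zs.
Context (x : nat) (hx : is_arm K x) (M Ms : scm R d1 d2).
Hypothesis MMs : latent_bandit_transfer Zs Ws K Ys M Ms.
Hypothesis pos : positivity M Ms x.

Lemma transport_context_ae (p : R.-pker (d1.-tuple R * nat) ~> R) :
  cond_Y_ZX M p ->
  exists N, [/\ measurable N, lawZ Ms N = 0, ~` Zs `<=` N &
    forall z B, ~ N z -> measurable B ->
      p (z, x) B = noise_kernel (mechY Ms) (z, x) B].
Proof.
move=> /cond_Y_ZX_ae[N [mN N0 Np]].
have [[_ [sZ _ _ _]] _ _ [_ sameY] _] := MMs.
(* The slice at [x] of the exceptional set: [Nx] times [[set x]] lies in the source-null set [N], so
   positivity makes [Nx] null for the target contexts. *)
pose Nx := (fun z => (z, x)) @^-1` N.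
have mNx : measurable Nx.
  by rewrite -[X in measurable X]setTI; apply: measurable_fun_pair.
have Nx0 : lawZ Ms Nx = 0.
  apply: pos => //; apply: (subset_measure0 _ mN _ N0).
    exact: measurableX.
  by move=> [z y] [/= Nz ->].
(* The mechanisms of Y are only known to agree on [Zs]; its complement is null because the target
   context never leaves [Zs]. *)
exists (~` Zs `|` Nx); split.
- by apply: measurableU => //; exact: measurableC.
- rewrite measureU0//; last exact: measurableC.
  have Z0 : @varZ _ _ _ Ms @^-1` (~` Zs) = set0.
    by apply/seteqP; split=> u //=; apply; exact: sZ.
  have : exo_law Ms (@varZ _ _ _ Ms @^-1` (~` Zs)) = 0 by rewrite Z0 measure0.
  exact.
- by left.
- move=> z B /not_orP[/contrapT Zz nN] mB.
  have -> : p (z, x) B = noise_kernel (mechY M) (z, x) B.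
    by apply: contrapT => pB; apply: nN; apply: Np => /= /(_ B mB).
  by rewrite !noise_kernelE// sameY.
Qed.

(** Both sides are kernels in [w]. Integrated over any [A], each equals the double integral of
    [noise_kernel (mechY Ms)] against [q w] and [lawW Ms], so [ae_eq_kernel] applies. *)
Lemma transport_formula (effect : R.-pker (d2.-tuple R) ~> R)
    (p : R.-pker (d1.-tuple R * nat) ~> R)
    (q : R.-pker (d2.-tuple R) ~> (d1.-tuple R)) :
  w_specific_effect Ms x effect -> cond_Y_ZX M p -> cond_Z_W Ms q ->
  \forall w \ae lawW Ms, forall B, measurable B ->
    effect w B = \int[q w]_(z in Zs) p (z, x) B.
Proof.
move=> eff /transport_context_ae[N [mN N0 ZsN pE]] qMs.
(* The integral of [q w N] over [w] is [lawZ Ms N], which is 0, and the integrand is nonnegative. *)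
have qN : \forall w \ae lawW Ms, q w N = 0.
  apply: (filterS (P := [set w | setT w -> q w N = cst 0 w])).
    by move=> w; exact.
  apply/ae_eq_integral_abs => //; first exact: measurable_kernel.
  transitivity (\int[lawW Ms]_w q w N).
    by apply: eq_integral => w _; rewrite gee0_abs.
  rewrite -[LHS]qMs// preimage_setT setTI.
  exact: N0.
have mpx B : measurable B -> measurable_fun setT (fun z => p (z, x) B).
  move=> mB; apply: (measurableT_comp (measurable_kernel p _ mB)).
  exact: measurable_fun_pair.
have mnx B : measurable B ->
    measurable_fun setT (fun z => noise_kernel (mechY Ms) (z, x) B).
  move=> mB.
  apply: (measurableT_comp (measurable_kernel (noise_kernel (mechY Ms)) _ mB)).
  exact: measurable_fun_pair.
have mpair : measurable_fun setT (fun z : d1.-tuple R => (z, x)).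
  exact: measurable_fun_pair.
(* Composition with the Dirac mass at [(z, x)] fixes the arm; a second composition averages over
   [q w], so the right-hand side becomes a kernel. *)
pose px : R.-spker (d1.-tuple R) ~> R := mkcomp_noparam (kdirac mpair) p.
pose pq : R.-ker (d2.-tuple R) ~> R := mkcomp_noparam q px.
have pqE w B : measurable B -> pq w B = \int[q w]_z p (z, x) B.
  move=> mB; apply: eq_integral => z _.
  rewrite [LHS]integral_dirac//; last exact: measurable_kernel.
  by rewrite diracT mul1e.
have : \forall w \ae lawW Ms, forall B, measurable B -> effect w B = pq w B.
  apply: ae_eq_kernel => A B mA mB.
  transitivity (\int[lawW Ms]_(w in A)
      \int[q w]_z noise_kernel (mechY Ms) (z, x) B).
    apply: (etrans (do_effect eff mA mB)).
    exact: (integral_cond_law qMs mA (mnx _ mB)).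
  apply: ge0_ae_eq_integral => //.
  - apply: measurable_funTS; apply: measurable_fun_integral_kernel => //.
      by move=> C mC; exact: measurable_kernel.
    exact: mnx.
  - by apply: measurable_funTS; exact: measurable_kernel.
  - by move=> w _; exact: integral_ge0.
  apply: filterS qN => w qwN _; rewrite pqE//.
  apply: ge0_ae_eq_integral => //; [exact: mnx|exact: mpx|].
  exists N; split => // z /= zN; apply: contrapT => nNz; apply: zN => _.
  by rewrite pE.
apply: filterS2 qN => w qwN effE B mB; rewrite effE// pqE//.
(* [q w] gives no mass to the complement of [Zs], which lies in [N]. *)
rewrite (@ge0_negligible_integral _ _ _ (q w) setT (~` Zs))//.
- by rewrite setTD setCK.
- exact: measurableC.
- exact: mpx.
- by apply: subset_measure0 ZsN _ => //; exact: measurableC.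
Qed.

End transport.

(** * The counterexample to direct transport *)

Lemma bernoulli_prob_set1 (R : realType) (p : R) b : (0 <= p <= 1)%R ->
  bernoulli_prob p [set b] = (if b then p else 1 - p)%:E.
Proof. by move=> p01; rewrite /bernoulli_prob p01 fsbig_set1. Qed.

(** The kernel depends on [f] alone, so two models with the same [f] share a version, as
    [covariate_shift] asks. *)
Lemma cond_law_kdirac d dV dT (U : measurableType d) (SV : measurableType dV)
    (ST : measurableType dT) (R : realType) (P : probability U R)
    (V : {mfun U >-> SV}) (T : {mfun U >-> ST}) (f : SV -> ST)
    (mf : measurable_fun setT f) :
  (forall u, T u = f (V u)) -> is_cond_law P V T (kdirac mf : R.-pker SV ~> ST).
Proof.
move=> TfV A B mA mB.
have mfB : measurable (f @^-1` B).
  by rewrite -[X in measurable X]setTI; exact: mf.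
transitivity (\int[distribution P V]_(v in A) (\1_(f @^-1` B) v)%:E);
  last by [].
rewrite integral_indic//; congr (P _).
by apply/seteqP; split=> u /=; rewrite TfV => -[].
Qed.

Lemma cond_law_cst d dV dT (U : measurableType d) (SV : measurableType dV)
    (ST : measurableType dT) (R : realType) (P : probability U R)
    (V : {mfun U >-> SV}) (T : {mfun U >-> ST}) v :
  (forall u, V u = v) ->
  is_cond_law P V T (kprobability (measurable_cst
    (distribution P T : pprobability ST R)) : R.-pker SV ~> ST).
Proof.
move=> Vv A B mA mB.
transitivity (\int[distribution P V]_(v in A) (cst (distribution P T B) v));
  last by [].
rewrite integral_cst//.
transitivity (P (T @^-1` B) * P (V @^-1` A)); last by [].
have [Av|nAv] := pselect (A v).
  have -> : V @^-1` A = setT by apply/seteqP; split=> u //= _; rewrite Vv.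
  by rewrite setTI probability_setT mule1.
have -> : V @^-1` A = set0 by apply/seteqP; split=> u //=; rewrite Vv.
by rewrite set0I measure0 mule0.
Qed.

Section not_transportable.
Context (R : realType) (d1 d2 K : nat).
Context (Zs : set (d1.-tuple R)) (Ws : set (d2.-tuple R)) (Ys : set R).
Context (x : nat) (hx : is_arm K x).
Context (z0 z1 : d1.-tuple R) (Zz0 : Zs z0) (Zz1 : Zs z1) (z01 : z0 <> z1).
Context (w : d2.-tuple R) (Ww : Ws w).
Context (y0 y1 : R) (Yy0 : Ys y0) (Yy1 : Ys y1) (y01 : y0 <> y1).

Let embZ (b : bool) : (bool * unit * unit * unit)%type := (b, tt, tt, tt).

Let measurable_embZ : measurable_fun setT embZ.
Proof. by []. Qed.

Let lawb (p : R) : probability (bool * unit * unit * unit)%type R :=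
  distribution (bernoulli_prob p) (mfun_of measurable_embZ).

Let lawb_indep p A B C D :
  measurable A -> measurable B -> measurable C -> measurable D ->
  lawb p (A `*` B `*` C `*` D) =
    lawb p [set u | A u.1.1.1] * lawb p [set u | B u.1.1.2] *
    lawb p [set u | C u.1.2] * lawb p [set u | D u.2].
Proof.
move=> _ _ _ _.
have null S : S = set0 -> bernoulli_prob p S = 0 by move=> ->; exact: measure0.
(* The noises of W, X and Y live in [unit], so their events are sure or impossible and only the
   Boolean noise of Z is random. *)
have cstE (Q : Prop) : bernoulli_prob p [set _ | Q] = (asbool Q)%:R%:E.
  have [q|nq] := asboolP Q; last by apply: null; apply/seteqP; split.
  rewrite (_ : [set _ | Q] = setT) ?probability_setT//.
  by apply/seteqP; split.
rewrite /lawb /distribution /pushforward/=.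
rewrite [X in _ = _ * X * _ * _](cstE (B tt)).
rewrite [X in _ = _ * _ * X * _](cstE (C tt)).
rewrite [X in _ = _ * _ * _ * X](cstE (D tt)).
have [b|nb] := asboolP (B tt); last first.
  by rewrite mule0 !mul0e null//; apply/seteqP; split=> u //= -[[[]]].
have [c|nc] := asboolP (C tt); last first.
  by rewrite mule0 !mul0e null//; apply/seteqP; split=> u //= -[[]].
have [e|ne] := asboolP (D tt); last first.
  by rewrite mule0 null//; apply/seteqP; split=> u //= -[].
rewrite !mule1; congr (bernoulli_prob p _).
by apply/seteqP; split=> u //= -[[[]]].
Qed.

Let ctx (b : bool) := if b then z0 else z1.

Let measurable_ctx : measurable_fun setT ctx.
Proof. by []. Qed.

Let reward (zx : d1.-tuple R * nat) : R := if zx.1 == z0 then y0 else y1.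

Let measurable_reward : measurable_fun setT reward.
Proof.
apply: measurable_fun_ifT => //.
apply: (measurable_fun_bool true).
rewrite setTI.
have -> : (fun zx : d1.-tuple R * nat => zx.1 == z0) @^-1` [set true] =
    [set z0] `*` setT.
  by apply/seteqP; split=> -[z n] /=; [move=> /eqP|move=> [-> _]; rewrite eqxx].
apply: measurableX => //.
apply: measurable_tuple_set1 => a; exact: measurable_set1.
Qed.

Let measurable_mechY : measurable_fun setT
  (fun zxu : d1.-tuple R * nat * unit => reward zxu.1).
Proof. exact: (measurableT_comp measurable_reward measurable_fst). Qed.

(** The arm is always [x] itself, so positivity at [x] only compares the laws of Z. *)
Let model (p : R) : scm R d1 d2 :=
  @Scm R d1 d2 _ _ _ _ bool unit unit unit (lawb p) (@lawb_indep p)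
    (mfun_of measurable_ctx) (cst w) (cst x) (mfun_of measurable_mechY).

Let lawZE p A : lawZ (model p) A = bernoulli_prob p (ctx @^-1` A).
Proof. by []. Qed.

Let half01 : (0 <= (2^-1 : R) <= 1)%R.
Proof. by rewrite invr_ge0 ler0n invf_le1// ler1n. Qed.

Let one01 : (0 <= (1 : R) <= 1)%R.
Proof. by rewrite ler01 lexx. Qed.

Let z10F : (z1 == z0) = false.
Proof. by apply/eqP => /esym. Qed.

Let mech_values p : takes_values Zs Ws K Ys (model p).
Proof.
by split=> [[]| | |z n u _ _] //=; rewrite /reward; case: ifP.
Qed.

Let same_mech p q : same_mechanisms_WY Zs K (model p) (model q).
Proof.
have cst_law (Q : Prop) :
    exo_law (model p) [set _ | Q] = exo_law (model q) [set _ | Q].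
  have [q'|nq] := pselect Q.
    have -> : [set _ : exo (model p) | Q] = setT by apply/seteqP; split.
    by rewrite !probability_setT.
  have -> : [set _ : exo (model p) | Q] = set0 by apply/seteqP; split.
  by rewrite !measure0.
by split=> *; exact: cst_law.
Qed.

Let bandit : latent_bandit_transfer Zs Ws K Ys (model 2^-1) (model 1).
Proof.
split=> //; split.
(* This event has probability 1/2 in the source and 0 in the target. *)
- exists [set z1]; first exact: measurable_tuple_set1.
  rewrite !lawZE (_ : ctx @^-1` [set z1] = [set false]).
    rewrite !bernoulli_prob_set1// subrr => -[] /eqP.
    by rewrite subr_eq0 eq_sym invr_eq1 pnatr_eq1.
  by apply/seteqP; split=> -[].
- exists (kdirac (measurable_cst w) : R.-pker d1.-tuple R ~> d2.-tuple R);
    exact: cond_law_kdirac.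
- exists (kdirac measurable_reward : R.-pker (d1.-tuple R * nat)%type ~> R);
    exact: cond_law_kdirac.
Qed.

Let pos : positivity (model 2^-1) (model 1) x.
Proof.
move=> A mA.
rewrite [X in X = _](_ : _ = bernoulli_prob 2^-1 (ctx @^-1` A)) => [A0|];
  last first.
  by congr bernoulli_prob; apply/seteqP; split=> b //= -[].
(* Each Boolean has weight 1/2 in the source, so only the empty event is null there. *)
rewrite lawZE (_ : ctx @^-1` A = set0) ?measure0//.
apply/seteqP; split=> // b Ab.
have : bernoulli_prob (2^-1 : R) [set b] = 0.
  by apply: subset_measure0 A0 => // _ ->.
rewrite bernoulli_prob_set1// => /eqP; rewrite eqe.
have -> : (1 - 2^-1 = 2^-1 :> R)%R by field.
by rewrite if_same invr_eq0 pnatr_eq0.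
Qed.

Lemma not_directly_transportable : ~ directly_transportable Zs Ws K Ys x.
Proof.
move=> /(_ _ _ bandit pos).
have effect p := @cond_law_cst _ _ _ _ _ _ _ (exo_law (do_scm (model p) x))
  (@varW _ _ _ (do_scm (model p) x)) (@varY _ _ _ (do_scm (model p) x)) w
  (fun=> erefl).
move=> /(_ _ _ (effect _) (effect _))[N [mN N0 NT]].
(* The two effects are constant in [v] and differ on [[set y0]] at every [v], so the exceptional
   null set would be the whole space. *)
have : lawW (model 1) setT = 0.
  apply: subset_measure0 N0 => // v _; apply: NT => /=.
  move=> /(_ [set y0] (measurable_set1 _)).
  have rE : (fun b => reward (ctx b, x)) @^-1` [set y0] = [set true].
    by apply/seteqP; split=> -[] //=; rewrite /reward/= ?eqxx ?z10F// => /esym.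
  have lawY p : distribution (exo_law (do_scm (model p) x))
      (@varY _ _ _ (do_scm (model p) x)) [set y0] = bernoulli_prob p [set true].
    exact: (congr1 (bernoulli_prob p) rE).
  move=> h; have := etrans (esym (lawY _)) (etrans h (lawY _)).
  rewrite !bernoulli_prob_set1// => -[] /esym/eqP.
  by rewrite invr_eq1 pnatr_eq1.
by rewrite probability_setT => /eqP; rewrite eqe oner_eq0.
Qed.

End not_transportable.

Theorem proposition4 (R : realType) (d1 d2 K : nat)
    (Zs : set (d1.-tuple R)) (Ws : set (d2.-tuple R)) (Ys : set R)
    (mZs : measurable Zs) (mWs : measurable Ws) (mYs : measurable Ys)
    (x : nat) (hx : is_arm K x) :
  ((exists z0 z1, [/\ Zs z0, Zs z1 & z0 <> z1]) ->
   (exists y0 y1, [/\ Ys y0, Ys y1 & y0 <> y1]) ->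
   (exists w, Ws w) ->
   ~ directly_transportable Zs Ws K Ys x)
  /\
  (forall M Ms : scm R d1 d2,
    latent_bandit_transfer Zs Ws K Ys M Ms -> positivity M Ms x ->
    forall (effect : R.-pker (d2.-tuple R) ~> R)
           (p_y_zx : R.-pker (d1.-tuple R * nat) ~> R)
           (ps_z_w : R.-pker (d2.-tuple R) ~> (d1.-tuple R)),
    w_specific_effect Ms x effect ->
    cond_Y_ZX M p_y_zx ->
    cond_Z_W Ms ps_z_w ->
    \forall w \ae lawW Ms, forall B, measurable B ->
      effect w B = \int[ps_z_w w]_(z in Zs) p_y_zx (z, x) B /\
      (countable Zs ->
       effect w B = \esum_(z in Zs) (p_y_zx (z, x) B * ps_z_w w [set z]))).
Proof.
split=> [[z0 [z1 [Zz0 Zz1 z01]]] [y0 [y1 [Yy0 Yy1 y01]]] [w Ww]|].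
  exact: (not_directly_transportable hx Zz0 Zz1 z01 Ww Yy0 Yy1 y01).
move=> M Ms MMs pos effect p q eff pM qMs.
apply: filterS (transport_formula mZs hx MMs pos eff pM qMs) => w effE B mB.
split; first exact: effE.
(* For countable [Zs] the integral becomes the sum, singletons of tuples being measurable. *)
move=> cZs; rewrite effE//; apply: integral_countable => //.
  by move=> z; apply: measurable_tuple_set1 => a; exact: measurable_set1.
apply: (measurableT_comp (measurable_kernel p _ mB)).
exact: measurable_fun_pair.
Qed.
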